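(* Let $P$ be the transition matrix of an irreducible Markov chain $X$ on the finite connected graph $G=(V,E)$, with stationary distribution $\mu$. Let $A,B\subset V$ be disjoint with $A\cup B\ne\emptyset$. Set up the electric network associated with the chain, that is, the network on $G$ with $$D_{xy}=\sqrt{\mu_xP_{xy}\,\mu_yP_{yx}},\qquad \gamma_{xy}=\sqrt{\frac{\mu_xP_{xy}}{\mu_yP_{yx}}}\qquad(x\sim y),$$ apply constant potential $1$ on all vertices of $A$, constant potential $0$ on all vertices of $B$, and leave all vertices of $V\setminus(A\cup B)$ free. Then the resulting potentials satisfy, for every $x\in V$, $$u_x=\mathbf P_x\{\tau^0_A<\tau^0_B\}.$$
   Context: Graphs are finite, connected and undirected, and loops are allowed; $x\sim y$ means that $x$ and $y$ are joined by an edge, with $x\sim x$ exactly when $x$ has a loop. A Markov chain on $G=(V,E)$ has $P_{xy}>0$ if and only if $x\sim y$ (in particular $P_{xy}>0\iff P_{yx}>0$, and $x$ has a loop iff $P_{xx}>0$). The chain need not be reversible. $\mathbf P_x$ is the law of the chain $X$ started from $x$, and $\tau^0_A=\inf\{t\ge0: X(t)\in A\}$, similarly $\tau^0_B$ ($\inf\emptyset=\infty$). An electric network on $G$ consists of resistances $R_{xy}=R_{yx}>0$ and amplifier parameters $\lambda_{xy}>0$ with $\lambda_{yx}=1/\lambda_{xy}$, given for all $x\sim y$, with $\lambda_{xx}=1$ on loops. Put $C_{xy}=1/R_{xy}$, $\gamma_{xy}=\sqrt{\lambda_{xy}}=1/\gamma_{yx}$, $D_{xy}=\frac{2\gamma_{xy}}{1+\lambda_{xy}}C_{xy}=D_{yx}$.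 (Thus symmetric values $D_{xy}>0$ and values $\gamma_{xy}=1/\gamma_{yx}>0$ determine the network by $\lambda_{xy}=\gamma_{xy}^2$, $C_{xy}=D_{xy}(1+\lambda_{xy})/(2\gamma_{xy})$.) Potentials $(u_x)_{x\in V}$ and currents are related by $i_{xy}=D_{xy}(\gamma_{yx}u_x-\gamma_{xy}u_y)$ for $x\sim y$. A vertex $x$ is free if $\sum_{y\sim x}i_{xy}=0$. For potentials prescribed on a nonempty set $W\subseteq V$, with all vertices of $V\setminus W$ free, there is a unique solution $(u,i)$. *)

(* Defs.v *)
From HB Require Import structures.
From mathcomp Require Import all_boot all_order all_algebra.
From mathcomp Require Import ring.
From mathcomp Require Import all_classical all_reals all_analysis.
Import Order.TTheory GRing.Theory Num.Theory.

Set Implicit Arguments.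
Unset Strict Implicit.
Unset Printing Implicit Defensive.

Local Open Scope classical_set_scope.
Local Open Scope ring_scope.

Definition connected_graph (V : finType) (e : rel V) : Prop :=
  symmetric e /\ forall x y, connect e x y.

Section Chains.
Context {R : realType} {V : finType}.
Implicit Types (P : V -> V -> R) (mu : V -> R) (e : rel V).

Definition stochastic P : Prop :=
  (forall x y, 0 <= P x y) /\ (forall x, \sum_y P x y = 1).

Definition chain_on_graph e P : Prop :=
  stochastic P /\ forall x y, 0 < P x y <-> e x y.

Fixpoint nstep P (n : nat) (x y : V) : R :=
  if n is m.+1 then \sum_z P x z * nstep P m z y else (x == y)%:R.

Definition irreducible_chain P : Prop :=
  forall x y, exists n, 0 < nstep P n x y.

Definition stationary_distribution P mu : Prop :=
  [/\ forall x, 0 <= mu x,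
      \sum_x mu x = 1
    & forall y, \sum_x mu x * P x y = mu y].

(* Since V is finite, measurability of each X n for the discrete sigma-algebra
   on V amounts to measurability of the events {X n = y}. *)
Definition markov_chain_from P (x : V) (d : measure_display)
    (Omega : measurableType d) (Pr : probability Omega R)
    (X : nat -> Omega -> V) : Prop :=
  (forall n y, measurable (X n @^-1` [set y])) /\
  (forall n (s : nat -> V),
     Pr [set w | forall i, (i <= n)%N -> X i w = s i] =
     ((s 0%N == x)%:R * \prod_(i < n) P (s i) (s i.+1))%:E).

(* The infimum is taken in the extended reals, so it is +oo if A is never
   visited. *)
Definition hitting_time (Omega : Type) (X : nat -> Omega -> V) (A : {set V})
    (w : Omega) : \bar R :=
  ereal_inf [set (n%:R)%:E | n in [set n : nat | X n w \in A]].

End Chains.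

Arguments hitting_time R {V Omega} X A w.

(* Resistances and amplifier parameters are total functions; only their values
   on edges are meaningful. *)
Record network (R : realType) (V : finType) (e : rel V) := Network {
  resistance : V -> V -> R;
  amplifier : V -> V -> R;
  resistance_gt0 : forall x y, e x y -> 0 < resistance x y;
  resistance_sym : forall x y, e x y -> resistance x y = resistance y x;
  amplifier_gt0 : forall x y, e x y -> 0 < amplifier x y;
  amplifier_inv : forall x y, e x y -> amplifier y x = (amplifier x y)^-1;
  amplifier_loop : forall x, e x x -> amplifier x x = 1 }.

Section Networks.
Context {R : realType} {V : finType} {e : rel V}.
Implicit Types (N : network R e) (u : V -> R).

Definition conductance N x y : R := (resistance N x y)^-1.

Definition gamma N x y : R := Num.sqrt (amplifier N x y).

Definition Dcond N x y : R :=
  2 * gamma N x y / (1 + amplifier N x y) * conductance N x y.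

Definition current N u x y : R :=
  Dcond N x y * (gamma N y x * u x - gamma N x y * u y).

Definition free_vertex N u x : Prop := \sum_(y | e x y) current N u x y = 0.

(* Potentials u prescribed to be v on W, all other vertices being free. *)
Definition network_solution N (W : {set V}) (v u : V -> R) : Prop :=
  (forall x, x \in W -> u x = v x) /\
  (forall x, x \notin W -> free_vertex N u x).

Lemma network_of_D_gamma (D g : V -> V -> R) :
    symmetric e ->
    (forall x y, e x y -> 0 < D x y) ->
    (forall x y, e x y -> D x y = D y x) ->
    (forall x y, e x y -> 0 < g x y) ->
    (forall x y, e x y -> g y x = (g x y)^-1) ->
  exists N, forall x y, e x y -> Dcond N x y = D x y /\ gamma N x y = g x y.
Proof.
move=> esym D0 Dsym g0 gV.
pose lam x y := g x y ^+ 2.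
pose C x y := D x y * (1 + lam x y) / (2 * g x y).
have lam0 x y : e x y -> 0 < lam x y by move=> /g0 h; rewrite exprn_gt0.
have C0 x y : e x y -> 0 < C x y.
  move=> exy; rewrite divr_gt0 ?mulr_gt0 ?D0 ?g0 ?addr_gt0 ?lam0 //.
have Cs x y : e x y -> C x y = C y x.
  move=> exy; rewrite /C /lam -(Dsym _ _ exy) (gV _ _ exy).
  by have := lt0r_neq0 (g0 _ _ exy) => gn; field.
have res0 x y : e x y -> 0 < (C x y)^-1 by move=> /C0; rewrite invr_gt0.
have ress x y : e x y -> (C x y)^-1 = (C y x)^-1 by move=> /Cs ->.
have lamV x y : e x y -> lam y x = (lam x y)^-1.
  by move=> exy; rewrite /lam (gV _ _ exy) exprVn.
have lam1 x : e x x -> lam x x = 1.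
  move=> exx; rewrite /lam expr2 {1}(gV _ _ exx) mulVf //.
  exact: lt0r_neq0 (g0 _ _ exx).
exists (Network res0 ress lam0 lamV lam1) => x y exy.
have gE : Num.sqrt (lam x y) = g x y.
  by rewrite /lam sqrtr_sqr gtr0_norm // g0.
split; last exact: gE.
rewrite /Dcond /gamma /conductance /= gE invrK /C.
have gn := lt0r_neq0 (g0 _ _ exy).
have ln : 1 + lam x y != 0 by rewrite lt0r_neq0 // addr_gt0 // lam0.
by field; apply/andP.
Qed.

End Networks.

(* Main.v *)
Require Import Defs.
From mathcomp Require Import all_boot all_order all_algebra.
From mathcomp Require Import lra.
From mathcomp Require Import all_classical all_reals all_analysis.
Import Order.TTheory GRing.Theory Num.Theory.
Import numFieldNormedType.Exports.
Local Open Scope ring_scope.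
Set Implicit Arguments.
Unset Strict Implicit.
Unset Printing Implicit Defensive.
Local Open Scope classical_set_scope.

(** Dividing out the square roots, the current from [x] to a neighbour [y] is
    [mu y * P y x * u x - mu x * P x y * u y]: the factor of [u x] is the
    stationary flow from [y] into [x], not the flow out of [x].  Summing over
    [y], stationarity turns the total inflow into [mu x], so [x] is free
    exactly when [u x] is the [P x]-average of [u].  This is the step where
    the amplifiers compensate for the lack of reversibility
    ([free_harmonic]).

    What remains is the probabilistic form of the Dirichlet problem on
    [W = A :|: B].  Let [a_n y] be the probability that [X n = y] while
    [X 0, ..., X n.-1] avoid [W].  A forward recursion
    [a_(n+1) z = \sum_(y notin W) a_n y * P y z] and harmonicity give
    [u x = \sum_(k < n) \sum_(y in W) a_k y * u y + \sum_y a_n y * u y]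
    for every [n] ([harmonic_absorption]).  The last term vanishes in the limit
    because the chain cannot avoid [W] forever: a Lyapunov function [g] with
    [P g + 1 <= g] off [W] bounds the sum of the surviving masses by [g x]
    ([exists_lyapunov], [surviving_mass_bound]).  As [u] is the indicator of
    [A] on [W], [u x] is the sum over [k] of the probabilities that the first
    visit to [W] takes place at time [k] and in [A].  These events partition
    [hitting_time A < hitting_time B], and sigma-additivity concludes
    ([prob_hitting_time_lt]). *)

(** * Harmonicity of the potentials *)

Section Harmonic.
Context {R : realType} {V : finType}.
Implicit Types (P : V -> V -> R) (mu u : V -> R) (e : rel V) (W : {set V}).

Lemma stationary_nstep P mu n y :
  stationary_distribution P mu -> \sum_x mu x * nstep P n x y = mu y.
Proof.
move=> [_ _ muP]; elim: n => [|n IHn] /=.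
  rewrite (bigD1 y) //= eqxx mulr1 big1 ?addr0 // => x /negbTE ->.
  by rewrite mulr0.
under eq_bigr do rewrite mulr_sumr.
rewrite exchange_big /= -[RHS]IHn; apply: eq_bigr => z _.
by rewrite -muP mulr_suml; apply: eq_bigr => x _; rewrite mulrA.
Qed.

Lemma nstep_ge0 P n x y : stochastic P -> 0 <= nstep P n x y.
Proof.
move=> [P0 _]; elim: n x => [|n IHn] x /=; first exact: ler0n.
by apply: sumr_ge0 => z _; rewrite mulr_ge0.
Qed.

(** Some vertex has positive mass, and stationarity over [n] steps carries a
    positive part of it to any vertex that it reaches in [n] steps. *)
Lemma stationary_gt0 P mu :
  stochastic P -> irreducible_chain P -> stationary_distribution P mu ->
  forall y, 0 < mu y.
Proof.
move=> Pst irr statmu y; have [mu0 mu1 _] := statmu.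
have [x mux] : exists x, 0 < mu x.
  apply/existsP; apply: contraT; rewrite negb_exists => /forallP muN.
  suff : \sum_x mu x <= 0 by rewrite mu1 ler10.
  by apply: sumr_le0 => z _; rewrite leNgt muN.
have [n nxy] := irr x y.
rewrite -(stationary_nstep n y statmu) (bigD1 x) //= ltr_wpDr ?mulr_gt0 //.
by apply: sumr_ge0 => z _; rewrite mulr_ge0 // nstep_ge0.
Qed.

Definition harmonic_off P W u : Prop :=
  forall x, x \notin W -> u x = \sum_y P x y * u y.

Lemma sqrtM_sqrt_div (a b : R) :
  0 < a -> 0 < b -> Num.sqrt (a * b) * Num.sqrt (a / b) = a.
Proof.
move=> a0 b0; rewrite -sqrtrM ?mulr_ge0 ?ltW //.
by rewrite mulrACA divff ?gt_eqF // mulr1 -expr2 sqrtr_sqr gtr0_norm.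
Qed.

(** The stationary equation at [x] collects the coefficients of [u x]; only the
    coefficients of the [u y] involve the transitions out of [x]. *)
Lemma free_harmonic e P mu (N : network R e) u x :
  symmetric e -> chain_on_graph e P -> stationary_distribution P mu ->
  (forall y, 0 < mu y) ->
  (forall x y, e x y ->
     Dcond N x y = Num.sqrt ((mu x * P x y) * (mu y * P y x))) ->
  (forall x y, e x y ->
     gamma N x y = Num.sqrt ((mu x * P x y) / (mu y * P y x))) ->
  free_vertex N u x -> u x = \sum_y P x y * u y.
Proof.
move=> esym [[P0 P1] Pe] [_ _ muP] mu0 ND Ng.
have PN y z : ~~ e y z -> P y z = 0.
  move=> neyz; apply/eqP; rewrite eq_le P0 andbT leNgt.
  by apply: contra neyz => /Pe.
have currentE y : e x y ->
    current N u x y = mu y * P y x * u x - mu x * P x y * u y.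
  move=> exy; have eyx : e y x by rewrite esym.
  have xy0 : 0 < mu x * P x y by rewrite mulr_gt0 //; apply/Pe.
  have yx0 : 0 < mu y * P y x by rewrite mulr_gt0 //; apply/Pe.
  rewrite /current mulrBr !mulrA ND // !Ng // sqrtM_sqrt_div //.
  by rewrite [X in Num.sqrt X * _]mulrC sqrtM_sqrt_div.
rewrite /free_vertex (eq_bigr _ currentE) big_mkcond /= => free.
have : mu x * (u x - \sum_y P x y * u y) = 0.
  rewrite -[RHS]free mulrBr -[X in X * u x]muP mulr_suml mulr_sumr -sumrB.
  apply: eq_bigr => y _; case: ifPn => [_|nexy]; first by rewrite mulrA.
  by rewrite (PN x y) // (PN y x) 1?esym // !mulr0 !mul0r mulr0 subrr.
by move/eqP; rewrite mulf_eq0 gt_eqF //= subr_eq0 => /eqP.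
Qed.

End Harmonic.

(** * Absorption of a chain on a target set *)

Section Absorption.
Context {R : realType} {V : finType} (P : V -> V -> R) (W : {set V}) (x : V).
Hypothesis Pst : stochastic P.

(** The law of [X n], for the chain started from [x], restricted to the event
    that [X 0, ..., X n.-1] avoid [W]; [X n] itself may lie in [W], so that the
    place of the first visit is recorded ([prob_killed]). *)
Fixpoint killed_law (n : nat) (y : V) : R :=
  if n is m.+1 then \sum_(z | z \notin W) killed_law m z * P z y
  else (x == y)%:R.

Lemma killed_law_ge0 n y : 0 <= killed_law n y.
Proof.
elim: n y => [|n IHn] y /=; first exact: ler0n.
by apply: sumr_ge0 => z _; rewrite mulr_ge0 //; case: Pst.
Qed.

Lemma sum_killed_lawS (g : V -> R) n :
  \sum_y killed_law n.+1 y * g y =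
  \sum_(y | y \notin W) killed_law n y * \sum_z P y z * g z.
Proof.
under eq_bigr do rewrite /= mulr_suml.
rewrite exchange_big /=; apply: eq_bigr => y _.
by rewrite mulr_sumr; apply: eq_bigr => z _; rewrite mulrA.
Qed.

Lemma sum_killed_law0 (g : V -> R) : \sum_y killed_law 0 y * g y = g x.
Proof.
rewrite (bigD1 x) //= eqxx mul1r big1 ?addr0 // => y.
by rewrite eq_sym => /negbTE ->; rewrite mul0r.
Qed.

Arguments killed_law : simpl never.

Definition surviving_mass n : R := \sum_(y | y \notin W) killed_law n y.

Lemma surviving_massE n :
  surviving_mass n = \sum_y killed_law n.+1 y.
Proof.
transitivity (\sum_y killed_law n.+1 y * 1).
  rewrite sum_killed_lawS; apply: eq_bigr => y _.
  under eq_bigr do rewrite mulr1.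
  by case: Pst => _ ->; rewrite mulr1.
by under eq_bigr do rewrite mulr1.
Qed.

Lemma surviving_mass_ge0 n : 0 <= surviving_mass n.
Proof. by apply: sumr_ge0 => y _; exact: killed_law_ge0. Qed.

Lemma surviving_mass_nonincreasing n k :
  (n <= k)%N -> surviving_mass k <= surviving_mass n.
Proof.
move=> /subnKC <-; elim: (k - n)%N => [|j IHj]; first by rewrite addn0.
rewrite addnS; apply: le_trans IHj.
rewrite [leRHS]surviving_massE [leRHS](bigID (mem W)) /=.
by rewrite ler_wpDl // sumr_ge0 // => y _; exact: killed_law_ge0.
Qed.

Lemma exists_lower_bound_pos :
  exists2 p : R, 0 < p & forall y z, 0 < P y z -> p <= P y z.
Proof.
exists (\big[Order.min/1]_(yz : V * V | 0 < P yz.1 yz.2) P yz.1 yz.2).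
  exact/lt_bigmin.
by move=> y z Pyz; rewrite (bigmin_le_cond _ (j := (y, z))).
Qed.

(** Let [d y] be the number of steps needed to reach a fixed [w \in W] from
    [y].  From [y \notin W] some possible step decreases [d], so the average of
    [eps ^+ d] after one step is at least [p * eps ^+ (d y).-1], where [p]
    bounds the positive transition probabilities from below.  Hence
    [eps ^+ d] at least doubles on average once [2 * eps <= p], that is, it
    gains at least its minimum [c], and [(1 - eps ^+ d) / c] loses at least
    [1]. *)
Lemma exists_lyapunov :
  irreducible_chain P -> W != finset.set0 ->
  exists2 g : V -> R, (forall y, 0 <= g y) &
    forall y, y \notin W -> \sum_z P y z * g z + 1 <= g y.
Proof.
move=> irr /set0Pn[w wW]; have [P0 P1] := Pst.
pose d y := ex_minn (irr y w).
have [p p0 pP] := exists_lower_bound_pos.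
pose eps := Num.min (p / 2) 1.
have eps0 : 0 < eps by rewrite lt_min divr_gt0 //=.
have eps1 : eps <= 1 by rewrite ge_min lexx orbT.
have epsp : 2 * eps <= p.
  by rewrite mulrC -ler_pdivlMr // ge_min lexx.
pose c := eps ^+ \max_y d y; have c0 : 0 < c by exact: exprn_gt0.
exists (fun y => (1 - eps ^+ d y) / c) => [y|y yW].
  by rewrite divr_ge0 ?subr_ge0 ?exprn_ile1 // ltW.
rewrite ler_pdivlMr // mulrDl mul1r mulr_suml.
under eq_bigr do rewrite mulrA divfK ?gt_eqF // mulrBr mulr1.
rewrite big_split sumrN P1 /= -addrA lerD2l -lerN2 opprD !opprK.
rewrite lerBrDr.
have : 0 < nstep P (d y) y w by rewrite /d; case: ex_minnP.
case dy : (d y) => [|n] /=.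
  by case: eqP => [yw|_]; [rewrite yw wW in yW|rewrite ltxx].
move=> nyw.
have [z Pyz nzw] : exists2 z, 0 < P y z & 0 < nstep P n z w.
  have [z /= h] : exists z, 0 < P y z * nstep P n z w.
    apply/existsP; apply: contraT; rewrite negb_exists => /forallP hN.
    move: nyw; rewrite ltNge => /negP[]; apply: sumr_le0 => z _.
    by rewrite leNgt hN.
  exists z; rewrite lt_def ?P0 ?nstep_ge0 // andbT.
    by apply: contraTneq h => ->; rewrite mul0r ltxx.
  by apply: contraTneq h => ->; rewrite mulr0 ltxx.
have dz : (d z <= n)%N by rewrite /d; case: ex_minnP => k _; apply.
have le_max : c <= eps ^+ n.+1.
  by rewrite ler_wiXn2l // ?(ltW eps0) // -dy leq_bigmax.
apply: (@le_trans _ _ (P y z * eps ^+ d z)); last first.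
  rewrite (bigD1 z) //= lerDl sumr_ge0 // => t _.
  by rewrite mulr_ge0 // exprn_ge0 // ltW.
apply: (@le_trans _ _ (p * eps ^+ n)); last first.
  by rewrite ler_pM ?exprn_ge0 ?pP ?(ltW p0) ?(ltW eps0) // ler_wiXn2l // ltW.
have : 2 * eps * eps ^+ n <= p * eps ^+ n.
  by rewrite ler_wpM2r // exprn_ge0 // ltW.
by rewrite -mulrA -exprS; lra.
Qed.

(** The [killed_law]-average of a Lyapunov function is nonnegative, starts at
    [g x], and loses at least [surviving_mass k] at step [k]; so the surviving
    masses sum up to at most [g x], and they are nonincreasing. *)
Lemma surviving_mass_bound :
  irreducible_chain P -> W != finset.set0 ->
  exists M : R, forall n, n.+1%:R * surviving_mass n <= M.
Proof.
move=> irr W0; have [g g0 gP] := exists_lyapunov irr W0.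
exists (g x) => n.
pose F k := \sum_y killed_law k y * g y.
have F0 k : 0 <= F k.
  by apply: sumr_ge0 => y _; rewrite mulr_ge0 ?killed_law_ge0.
have step k : F k.+1 + surviving_mass k <= F k.
  rewrite /F sum_killed_lawS /surviving_mass -big_split /=.
  rewrite [leRHS](bigID (mem W)) /= ler_wpDl //.
    by apply: sumr_ge0 => y _; rewrite mulr_ge0 ?killed_law_ge0.
  apply: ler_sum => y yW; rewrite -[X in _ + X]mulr1 -mulrDr.
  by rewrite ler_wpM2l ?killed_law_ge0 ?gP.
have acc k : F k + \sum_(i < k) surviving_mass i <= g x.
  elim: k => [|k IHk]; first by rewrite big_ord0 addr0 /F sum_killed_law0.
  rewrite big_ord_recr /=; have := step k; lra.
apply: le_trans (acc n.+1); rewrite ler_wpDl //.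
rewrite mulr_natl -[X in _ *+ X]card_ord -sumr_const; apply: ler_sum => i _.
by apply: surviving_mass_nonincreasing; rewrite -ltnS.
Qed.

Lemma surviving_mass_cvg0 :
  irreducible_chain P -> W != finset.set0 ->
  surviving_mass n @[n --> \oo] --> (0 : R).
Proof.
move=> irr W0; have [M MP] := surviving_mass_bound irr W0.
apply: (@squeeze_cvgr _ _ _ _ (fun=> 0) (fun n => M * n.+1%:R^-1)).
- apply: nearW => n; rewrite surviving_mass_ge0 /=.
  by rewrite ler_pdivlMr // mulrC MP.
- exact: cvg_cst.
- rewrite -(mulr0 M); apply: cvgMr; exact: cvg_harmonic.
Qed.

(** Optional stopping at the minimum of [n] and the first visit to [W]: the mass
    absorbed before time [n] keeps the value of [u] where it was absorbed, and
    the remaining mass moves without changing the average of [u]. *)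
Lemma harmonic_absorption (u : V -> R) n :
  harmonic_off P W u ->
  u x = \sum_(0 <= k < n) \sum_(y in W) killed_law k y * u y
        + \sum_y killed_law n y * u y.
Proof.
move=> uP; elim: n => [|n IHn].
  by rewrite big_geq // add0r sum_killed_law0.
rewrite IHn big_nat_recr //= -addrA; congr (_ + _).
rewrite (bigID (mem W)) /=; congr (_ + _); rewrite sum_killed_lawS.
by apply: eq_bigr => y yW; rewrite -uP.
Qed.

Lemma harmonic_absorption_cvg (u : V -> R) :
  irreducible_chain P -> W != finset.set0 -> harmonic_off P W u ->
  \sum_(0 <= k < n) \sum_(y in W) killed_law k y * u y @[n --> \oo] --> u x.
Proof.
move=> irr W0 uP.
pose U := \sum_y `|u y|.
have uU y : `|u y| <= U.
  by rewrite /U (bigD1 y) //= lerDl sumr_ge0.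
rewrite -cvg_shiftS /=.
have -> : (fun n => \sum_(0 <= k < n.+1) \sum_(y in W) killed_law k y * u y) =
  (fun n => u x - \sum_y killed_law n.+1 y * u y).
  by apply/funext => n; rewrite (harmonic_absorption n.+1 uP) addrK.
suff : (u x - \sum_y killed_law n.+1 y * u y) @[n --> \oo] --> u x - 0.
  by rewrite subr0.
apply: cvgB; first exact: cvg_cst.
apply: norm_cvg0.
apply: (@squeeze_cvgr _ _ _ _ (fun=> 0) (fun n => surviving_mass n * U)).
- apply: nearW => n; rewrite normr_ge0 /= surviving_massE mulr_suml.
  apply: le_trans (ler_norm_sum _ _ _) _; apply: ler_sum => y _.
  by rewrite normrM (ger0_norm (killed_law_ge0 _ _)) ler_wpM2l ?killed_law_ge0.
- exact: cvg_cst.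
- rewrite -(mul0r U); apply: cvgMl; exact: surviving_mass_cvg0.
Qed.

End Absorption.

(** * Probabilities of paths *)

Section FiniteRange.
Context {R : realType} {d : measure_display} {Omega : measurableType d}.
Context {T : finType} (h : Omega -> T).
Hypothesis h_meas : forall t, measurable (h @^-1` [set t]).

Lemma measurable_preimage_finite (Q : set T) : measurable (h @^-1` Q).
Proof.
have -> : h @^-1` Q = \bigcup_(t in Q) (h @^-1` [set t]).
  by apply/seteqP; split=> [w Qw|w [t Qt /= ->]] //; exists (h w).
by apply: fin_bigcup_measurable.
Qed.

Lemma law_of_total_probability (Pr : probability Omega R) (F : set Omega) :
  measurable F -> Pr F = (\sum_t Pr (F `&` h @^-1` [set t]))%E.
Proof.
move=> mF.
have {1}-> : F = \bigcup_(t in [set: T]) (F `&` h @^-1` [set t]).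
  by apply/seteqP; split=> [w Fw|w [t _ []]] //; exists (h w).
have enumT : [set: T] = [set` index_enum T].
  by apply/seteqP; split=> t _ //=; rewrite mem_index_enum.
rewrite measure_fin_bigcup //.
- by rewrite enumT -fsbig_seq // index_enum_uniq.
- exact: finite_finset.
- by move=> s t _ _ [w [[_ /= <-] [_ /= <-]]].
- by move=> t _; apply: measurableI.
Qed.

End FiniteRange.

Section MarkovChain.
Context {R : realType} {V : finType} (P : V -> V -> R) (x : V).
Context {d : measure_display} {Omega : measurableType d}.
Context (Pr : probability Omega R) (X : nat -> Omega -> V).
Hypothesis XP : markov_chain_from P x Pr X.

Lemma measurable_state n (Q : set V) : measurable (X n @^-1` Q).
Proof. by apply: measurable_preimage_finite => y; case: XP. Qed.

Definition history n (w : Omega) : {ffun 'I_n.+1 -> V} :=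
  [ffun i : 'I_n.+1 => X i w].

Lemma history_preimage1 n (s : nat -> V) :
  history n @^-1` [set [ffun i : 'I_n.+1 => s i]] =
  [set w | forall i, (i <= n)%N -> X i w = s i].
Proof.
apply/seteqP; split=> [w /= /ffunP hs i le_in|w /= hs].
  by have := hs (Ordinal (le_in : (i < n.+1)%N)); rewrite !ffunE.
by apply/ffunP => i; rewrite !ffunE hs // -ltnS.
Qed.

Lemma measurable_history n t : measurable (history n @^-1` [set t]).
Proof.
have -> : history n @^-1` [set t] =
    \bigcap_(i in [set: 'I_n.+1]) (X i @^-1` [set t i]).
  apply/seteqP; split=> [w /= <- i _|w /= ht].
    by rewrite /= ffunE.
  by apply/ffunP => i; rewrite ffunE; exact: ht i I.
by apply: fin_bigcap_measurable => // i _; exact: measurable_state.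
Qed.

(** The finite-dimensional distributions specify single paths; summing over the
    finitely many paths in [Q] gives the Markov property for every event that
    depends on the past up to time [n] and fixes the state at time [n]. *)
Lemma markov_property n (Q : pred {ffun 'I_n.+1 -> V}) y z :
  (forall t, Q t -> t ord_max = y) ->
  Pr (history n @^-1` [set` Q] `&` X n.+1 @^-1` [set z]) =
  (Pr (history n @^-1` [set` Q]) * (P y z)%:E)%E.
Proof.
move=> Qy.
have mQ : measurable (history n @^-1` [set` Q]).
  by apply: measurable_preimage_finite => t; exact: measurable_history.
have mz := measurable_state n.+1 [set z].
have mh := @measurable_history n.
rewrite (law_of_total_probability mh Pr mQ).
rewrite (law_of_total_probability mh Pr (measurableI _ _ mQ mz)).
rewrite ge0_sume_distrl; last by move=> t _; exact: measure_ge0.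
apply: eq_bigr => t _; have [Qt|nQt] := boolP (Q t); last first.
  rewrite setIAC (_ : _ `&` history n @^-1` [set t] = set0).
    by rewrite set0I measure0 mul0e.
  by apply/seteqP; split=> // w [/= Qw tw]; move: nQt; rewrite -tw => /negP.
(* The path [t] followed by [z], as a sequence. *)
pose s i := if (i <= n)%N then t (inord i) else z.
have tE : t = [ffun i : 'I_n.+1 => s i].
  by apply/ffunP => i; rewrite ffunE /s -ltnS ltn_ord inord_val.
have hE : history n @^-1` [set` Q] `&` history n @^-1` [set t] =
    [set w | forall i, (i <= n)%N -> X i w = s i].
  rewrite -history_preimage1 -tE; apply/seteqP; split=> [w []|w /= tw] //.
  by split => //=; rewrite tw.
have hE' : history n @^-1` [set` Q] `&` X n.+1 @^-1` [set z]
      `&` history n @^-1` [set t] =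
    [set w | forall i, (i <= n.+1)%N -> X i w = s i].
  rewrite setIAC hE; apply/seteqP; split=> [w [/= ws wz] i|w /= ws].
    rewrite leq_eqVlt => /predU1P[->|/ws//].
    by rewrite /s ltnn.
  split=> /= [i le_in|]; first by apply: ws; exact: leqW.
  by rewrite ws // /s ltnn.
have [_ cyl] := XP.
rewrite hE hE' !cyl -EFinM big_ord_recr /= mulrA; congr (_ * P _ _)%:E.
- rewrite /s leqnn -(Qy _ Qt); congr (t _); apply: val_inj.
  by rewrite /= inordK.
- by rewrite /s ltnn.
Qed.

Definition avoids (W : {set V}) n : set Omega :=
  [set w | forall i, (i < n)%N -> X i w \notin W].

(** Encodes the event as a predicate on histories, which is the form required by
    [markov_property]. *)
Lemma avoidsE W n (Q : set V) :
  avoids W n `&` X n @^-1` Q =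
  history n @^-1` [set` [pred t : {ffun 'I_n.+1 -> V} |
    [forall i : 'I_n.+1, (i < n)%N ==> (t i \notin W)] && (t ord_max \in Q)]].
Proof.
apply/seteqP; split=> [w [/= av Qw]|w /= /andP[/forallP av]].
  rewrite /history /=; apply/andP; split; last by rewrite ffunE inE.
  by apply/forallP => i; apply/implyP => lt_in; rewrite ffunE av.
rewrite ffunE inE => Qw; split=> // i lt_in.
have := av (Ordinal (leqW lt_in : (i < n.+1)%N)).
by rewrite lt_in /= ffunE.
Qed.

Lemma measurable_avoids W n (Q : set V) :
  measurable (avoids W n `&` X n @^-1` Q).
Proof.
rewrite avoidsE; apply: measurable_preimage_finite => t.
exact: measurable_history.
Qed.

Lemma avoidsS (W : {set V}) n y : y \notin W ->
  avoids W n.+1 `&` X n @^-1` [set y] = avoids W n `&` X n @^-1` [set y].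
Proof.
move=> yW; apply/seteqP; split=> w [/= av wy]; split=> // i lt_in.
  by apply: av; exact: leqW.
by move: lt_in; rewrite ltnS leq_eqVlt => /predU1P[->|/av//]; rewrite wy.
Qed.

Lemma prob_killed W n y :
  Pr (avoids W n `&` X n @^-1` [set y]) = (killed_law P W x n y)%:E.
Proof.
elim: n y => [|n IHn] z.
  have [_ /(_ 0%N (fun=> z))] := XP; rewrite big_ord0 mulr1 eq_sym /= => <-.
  congr (Pr _); apply/seteqP; split=> [w [_ /= wz] i|w /= wz].
    by rewrite leqn0 => /eqP ->.
  by split=> //=; exact: wz.
rewrite (law_of_total_probability (h := X n)
  (fun t => measurable_state n [set t]) Pr (measurable_avoids _ _ _)) /=.
rewrite -sumEFin [RHS]big_mkcond /=; apply: eq_bigr => y _.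
case: ifPn => [yW|/negPn yW]; last first.
  rewrite (_ : _ `&` _ = set0) ?measure0 //; apply/seteqP; split=> // w.
  by move=> [[/= av _] wy]; have := av n (ltnSn n); rewrite wy yW.
rewrite setIAC avoidsS // EFinM -IHn avoidsE.
by apply: markov_property => t /= /andP[_]; rewrite inE.
Qed.

Lemma prob_hit W (A : {set V}) n :
  Pr (avoids W n `&` X n @^-1` [set` A]) =
  (\sum_(y in A) killed_law P W x n y)%:E.
Proof.
rewrite (law_of_total_probability (h := X n)
  (fun t => measurable_state n [set t]) Pr (measurable_avoids _ _ _)) /=.
rewrite -sumEFin [RHS]big_mkcond /=; apply: eq_bigr => y _.
rewrite -prob_killed -setIA; case: ifPn => yA.
  congr (Pr (_ `&` _)); apply/seteqP; split=> [w []//|w /= wy].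
  by split=> //=; rewrite wy.
rewrite [X in _ `&` X](_ : _ = set0) ?setI0 ?measure0 //.
by apply/seteqP; split=> // w [/= + wy]; rewrite wy (negbTE yA).
Qed.

(** The strict inequality forces [hitting_time A] to be finite; taking the first
    visit to [A], an earlier visit to [B] would contradict the inequality.
    Conversely a visit to [B] at the time of the first visit to [A] is excluded
    by disjointness, so [B] is hit at least one step later. *)
Lemma hitting_time_ltE (A B : {set V}) w : [disjoint A & B]%B ->
  (hitting_time R X A w < hitting_time R X B w)%E <->
  exists n, (avoids (A :|: B) n `&` X n @^-1` [set` A]) w.
Proof.
move=> AB; split=> [|[n [/= av wA]]].
  move=> /ereal_inf_lt[_ [/= n nA <-] nB].
  have exA : exists n, X n w \in A by exists n.
  case: (ex_minnP exA) => k kA kmin; exists k; split=> //= i lt_ik.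
  rewrite inE negb_or; apply/andP; split.
    by apply/negP => /kmin; rewrite leqNgt lt_ik.
  apply/negP => iB; move: nB; rewrite ltNge => /negP; apply.
  apply: (@le_trans _ _ (i%:R)%:E).
    by apply: ereal_inf_lbound; exists i.
  by rewrite lee_fin ler_nat (leq_trans (ltnW lt_ik)) // kmin.
apply: (@le_lt_trans _ _ (n%:R)%:E).
  by apply: ereal_inf_lbound; exists n.
apply: (@lt_le_trans _ _ (n.+1%:R)%:E); first by rewrite lte_fin ltr_nat.
apply: le_ereal_inf_tmp => _ [/= m mB <-]; rewrite lee_fin ler_nat ltnNge.
rewrite leq_eqVlt; apply/norP; split.
  by apply/eqP => mn; move: mB; rewrite mn (disjointFr AB wA).
by apply/negP => /av; rewrite inE mB orbT.
Qed.

Lemma prob_hitting_time_lt (A B : {set V}) : [disjoint A & B]%B ->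
  (\sum_(0 <= k < n) (\sum_(y in A) killed_law P (A :|: B) x k y)%:E)%E
     @[n --> \oo] -->
  Pr [set w | (hitting_time R X A w < hitting_time R X B w)%E].
Proof.
move=> AB; pose F n := avoids (A :|: B) n `&` X n @^-1` [set` A].
have -> : [set w | (hitting_time R X A w < hitting_time R X B w)%E] =
    \bigcup_n F n.
  apply/seteqP; split=> w /=.
    by move=> /hitting_time_ltE[]// n Fw; exists n.
  by move=> [n _ Fw]; apply/hitting_time_ltE => //; exists n.
have trivF : trivIset setT F.
  apply: ltn_trivIset => m n lt_nm.
  apply/seteqP; split=> // w [[_ /= wA] [av _]].
  by have := av _ lt_nm; rewrite inE wA.
have mF n : measurable (F n) by exact: measurable_avoids.
under eq_fun do under eq_bigr do rewrite -(prob_hit (A :|: B)).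
by apply: (measure_semi_sigma_additive F mF trivF); exact: bigcup_measurable.
Qed.

End MarkovChain.

(** * Potentials and hitting probabilities *)

Theorem theorem3p2 (R : realType) (V : finType) (e : rel V)
    (P : V -> V -> R) (mu : V -> R) (A B : {set V})
    (N : network R e) (u : V -> R) :
  connected_graph e ->
  chain_on_graph e P ->
  irreducible_chain P ->
  stationary_distribution P mu ->
  [disjoint A & B]%B ->
  A :|: B != finset.set0 ->
  (forall x y, e x y ->
     Dcond N x y = Num.sqrt ((mu x * P x y) * (mu y * P y x))) ->
  (forall x y, e x y ->
     gamma N x y = Num.sqrt ((mu x * P x y) / (mu y * P y x))) ->
  network_solution N (A :|: B) (fun x => (x \in A)%:R) u ->
  forall (x : V) (d : measure_display) (Omega : measurableType d)
    (Pr : probability Omega R) (X : nat -> Omega -> V),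
    markov_chain_from P x Pr X ->
    (u x)%:E =
      Pr [set w | (hitting_time R X A w < hitting_time R X B w)%E]%classic.
Proof.
move=> [e_sym _] PG irr statmu AB W0 ND Ng [uW ufree] x d Omega Pr X XP.
have Pst : stochastic P by case: PG.
have mu0 := stationary_gt0 Pst irr statmu.
have harm : harmonic_off P (A :|: B) u.
  by move=> y /ufree; exact: (free_harmonic e_sym PG statmu mu0 ND Ng).
have ucvg := harmonic_absorption_cvg (x := x) Pst irr W0 harm.
have uA k : \sum_(y in A :|: B) killed_law P (A :|: B) x k y * u y =
    \sum_(y in A) killed_law P (A :|: B) x k y.
  rewrite [RHS]big_mkcond [LHS]big_mkcond /=; apply: eq_bigr => y _.
  case: ifPn => [/uW ->|]; first by case: ifP; rewrite ?mulr1 ?mulr0.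
  by rewrite inE negb_or => /andP[/negbTE ->].
rewrite -(cvg_lim (@ereal_hausdorff R) (prob_hitting_time_lt XP AB)).
apply: esym; apply: cvg_lim; first exact: ereal_hausdorff.
under eq_fun do rewrite sumEFin.
apply: cvg_EFin; first exact: nearW.
by move: ucvg; under eq_fun do under eq_bigr do rewrite uA.
Qed.
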